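(* Let $R$ be a Dedekind domain with quotient field $K$. (i) A non-zero torsion $R$-module $M$ is strongly self-regular if and only if $M\cong \bigoplus_{i\in I} R/P_i$ for some distinct maximal ideals $P_i$ of $R$. (ii) A non-zero finitely generated $R$-module $M$ is strongly self-regular if and only if $M\cong \bigoplus_{i=1}^k R/P_i$ for some distinct maximal ideals $P_i$ of $R$. (iii) A non-zero injective $R$-module $M$ is strongly self-regular if and only if $M\cong K$.
   Context: A direct summand of a module $X$ is fully invariant if it is mapped into itself by every endomorphism of $X$. A module $N$ is strongly self-regular if for every endomorphism $f:N\to N$, both ${\rm Ker}(f)$ and ${\rm Im}(f)$ are fully invariant direct summands of $N$. *)

(* Defs.v *)
From HB Require Import structures.
From mathcomp Require Import all_boot all_algebra.
From mathcomp Require Import generic_quotient.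
From mathcomp Require Import boolp classical_sets cardinality.

Set Implicit Arguments.
Unset Strict Implicit.
Unset Printing Implicit Defensive.

Import GRing.Theory.
Local Open Scope ring_scope.
Local Open Scope classical_set_scope.
Local Open Scope quotient_scope.

Local Notation "x %:F" := (@FracField.tofrac _ x).

Section Summands.
Variables (R : pzRingType) (M : lmodType R).

Definition submodule (A : set M) : Prop := submod_closed [in A].

Definition direct_summand (A : set M) : Prop :=
  submodule A /\
  exists B : set M, [/\ submodule B, A `&` B = [set 0] &
                        [set x + y | x in A & y in B] = setT].

Definition fully_invariant (A : set M) : Prop :=
  forall f : {linear M -> M}, f @` A `<=` A.

Definition strongly_self_regular : Prop :=
  forall f : {linear M -> M},
    [/\ direct_summand (f @^-1` [set 0]), fully_invariant (f @^-1` [set 0]),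
        direct_summand (range f) & fully_invariant (range f)].

Definition nonzero_module : Prop := exists x : M, x != 0.

Definition torsion_module : Prop :=
  forall x : M, exists2 a : R, a != 0 & a *: x = 0.

Definition fin_gen_module : Prop :=
  exists (n : nat) (g : 'I_n -> M),
    forall x : M, exists c : 'I_n -> R, x = \sum_(i < n) c i *: g i.

Definition injective_module : Prop :=
  forall (A B : lmodType R) (i : {linear A -> B}) (g : {linear A -> M}),
    injective i -> exists h : {linear B -> M}, forall x : A, h (i x) = g x.

End Summands.

Definition isomorphic_modules (R : pzRingType) (M N : lmodType R) : Prop :=
  exists f : {linear M -> N}, bijective f.

Section DirectProduct.
Variables (R : pzRingType) (I : Type) (M : I -> lmodType R).

Definition direct_product : Type := forall i, M i.

Implicit Types x y z : direct_product.

HB.instance Definition _ := gen_eqMixin direct_product.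
HB.instance Definition _ := gen_choiceMixin direct_product.

Let zero : direct_product := fun=> 0.
Let opp x : direct_product := fun i => - x i.
Let add x y : direct_product := fun i => x i + y i.
Let scale (a : R) x : direct_product := fun i => a *: x i.

Fact direct_product_addA : associative add.
Proof. by move=> x y z; apply: functional_extensionality_dep => i; exact: addrA. Qed.

Fact direct_product_addC : commutative add.
Proof. by move=> x y; apply: functional_extensionality_dep => i; exact: addrC. Qed.

Fact direct_product_add0 : left_id zero add.
Proof. by move=> x; apply: functional_extensionality_dep => i; exact: add0r. Qed.

Fact direct_product_addN : left_inverse zero opp add.
Proof. by move=> x; apply: functional_extensionality_dep => i; exact: addNr. Qed.

HB.instance Definition _ := GRing.isZmodule.Build direct_product
  direct_product_addA direct_product_addC direct_product_add0
  direct_product_addN.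

Fact direct_product_scaleA a b x : scale a (scale b x) = scale (a * b) x.
Proof. by apply: functional_extensionality_dep => i; exact: scalerA. Qed.

Fact direct_product_scale1 : left_id 1 scale.
Proof. by move=> x; apply: functional_extensionality_dep => i; exact: scale1r. Qed.

Fact direct_product_scaleDr : right_distributive scale +%R.
Proof. by move=> a x y; apply: functional_extensionality_dep => i; exact: scalerDr. Qed.

Fact direct_product_scaleDl x : {morph scale^~ x : a b / a + b}.
Proof. by move=> a b; apply: functional_extensionality_dep => i; exact: scalerDl. Qed.

HB.instance Definition _ := GRing.Zmodule_isLmodule.Build R direct_product
  direct_product_scaleA direct_product_scale1 direct_product_scaleDr
  direct_product_scaleDl.

Definition fin_supported : {pred direct_product} :=
  fun x => `[< finite_set [set i | x i != 0] >].

Fact fin_supported_submod : submod_closed fin_supported.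
Proof.
split=> [|a x y /asboolP finx /asboolP finy]; apply/asboolP.
  apply: (@sub_finite_set _ _ set0) => [i /=|]; last exact: finite_set0.
  by rewrite eqxx.
apply: (@sub_finite_set _ _ ([set i | x i != 0] `|` [set i | y i != 0])).
  move=> i /= nz; have [xi0|] := eqVneq (x i) 0; last by left.
  right; apply: contraNN nz => /eqP yi0.
  by rewrite /GRing.add /= /add /GRing.scale /= /scale xi0 yi0 scaler0 addr0.
by rewrite finite_setU.
Qed.

HB.instance Definition _ :=
  GRing.isSubmodClosed.Build R direct_product fin_supported
    fin_supported_submod.

Record direct_sum : Type := DirectSum {
  direct_sum_val : direct_product;
  _ : direct_sum_val \in fin_supported
}.

HB.instance Definition _ := [isSub for direct_sum_val].
HB.instance Definition _ := [Choice of direct_sum by <:].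
HB.instance Definition _ := [SubChoice_isSubLmodule of direct_sum by <:].

End DirectProduct.

(* R / P as an R-module, on the carrier of the quotient ring {ideal_quot P}. *)
Section QuotientModule.
Variables (R : comNzRingType) (P : idealr R).

Definition quot_module : Type := {ideal_quot P}.

HB.instance Definition _ := GRing.Zmodule.on quot_module.

Let scale (a : R) (x : quot_module) : quot_module :=
  \pi_({ideal_quot P}) a * (x : {ideal_quot P}).

Fact quot_module_scaleA a b x : scale a (scale b x) = scale (a * b) x.
Proof. by rewrite /scale mulrA -rmorphM. Qed.

Fact quot_module_scale1 : left_id 1 scale.
Proof. by move=> x; rewrite /scale rmorph1 mul1r. Qed.

Fact quot_module_scaleDr : right_distributive scale +%R.
Proof. by move=> a x y; exact: mulrDr. Qed.

Fact quot_module_scaleDl x : {morph scale^~ x : a b / a + b}.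
Proof. by move=> a b; rewrite /scale rmorphD mulrDl. Qed.

HB.instance Definition _ := GRing.Zmodule_isLmodule.Build R quot_module
  quot_module_scaleA quot_module_scale1 quot_module_scaleDr
  quot_module_scaleDl.

End QuotientModule.

(* The quotient field {fraction R} as an R-module. *)
Section FractionModule.
Variable R : idomainType.

Definition fraction_module : Type := {fraction R}.

HB.instance Definition _ := GRing.Zmodule.on fraction_module.

Let scale (a : R) (x : fraction_module) : fraction_module := a%:F * (x : {fraction R}).

Fact fraction_module_scaleA a b x : scale a (scale b x) = scale (a * b) x.
Proof. by rewrite /scale mulrA -rmorphM. Qed.

Fact fraction_module_scale1 : left_id 1 scale.
Proof. by move=> x; rewrite /scale rmorph1 mul1r. Qed.

Fact fraction_module_scaleDr : right_distributive scale +%R.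
Proof. by move=> a x y; exact: mulrDr. Qed.

Fact fraction_module_scaleDl x : {morph scale^~ x : a b / a + b}.
Proof. by move=> a b; rewrite /scale rmorphD mulrDl. Qed.

HB.instance Definition _ := GRing.Zmodule_isLmodule.Build R fraction_module
  fraction_module_scaleA fraction_module_scale1 fraction_module_scaleDr
  fraction_module_scaleDl.

End FractionModule.

(* idealr R is the type of proper ideals of R. *)
Definition maximal_ideal (R : comNzRingType) (P : idealr R) : Prop :=
  forall J : idealr R, {subset P <= J} -> J =i P.

(* Proper ideals suffice: R itself is generated by 1. *)
Definition noetherian_ring (R : comNzRingType) : Prop :=
  forall J : idealr R, exists s : seq R, forall x : R,
    x \in J <-> exists c : 'I_(size s) -> R, x = \sum_(i < size s) c i * s`_i.

Definition integrally_closed (R : idomainType) : Prop :=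
  forall u : {fraction R},
    integralOver (@FracField.tofrac R) u -> exists r : R, u = r%:F.

(* Noetherian, integrally closed, of Krull dimension at most 1; fields are
   included. *)
Definition dedekind_domain (R : idomainType) : Prop :=
  [/\ noetherian_ring R, integrally_closed R &
      forall P : prime_idealr R,
        (exists2 x : R, x \in P & x != 0) -> maximal_ideal P].

(* Equality of ideals is extensional: idealr R carries closure proofs. *)
Definition distinct_ideals (R : comNzRingType) (I : Type) (P : I -> idealr R)
  : Prop := forall i j : I, P i =i P j -> i = j.

(* Main.v *)
(* If [M] is strongly self-regular, then for every endomorphism [f] the module
   splits as [ker f + im f] by a central idempotent, and [f] is invertible on
   [im f]; in particular [M] has no nonzero nilpotent endomorphism.  Applied to
   multiplication by the generators of a maximal ideal [P], this splits off the
   [P]-socle of [M].  By Noetherian induction, when all primes that annihilate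
   elements of [M] are maximal, [M] is the sum of these socles, and absence of
   nilpotents makes each of them at most one-dimensional over [R / P].
   By the determinant trick, such an [M] that is finitely generated and not
   torsion is only possible over a field.  An injective module is divisible, hence
   torsion-free when strongly self-regular; two independent elements would again
   give a nilpotent endomorphism, by injectivity. *)

From HB Require Import structures.
Require Import Defs.
From mathcomp Require Import all_boot all_algebra ring.
From mathcomp Require Import generic_quotient.
From mathcomp Require Import boolp classical_sets cardinality.

Set Implicit Arguments.
Unset Strict Implicit.
Unset Printing Implicit Defensive.

Import GRing.Theory.
Local Open Scope ring_scope.
Local Open Scope classical_set_scope.
Local Open Scope quotient_scope.

Local Notation "x %:F" := (@FracField.tofrac _ x).

(** * Linear maps from functional relations *)

(** Two values over one [x] differ by a value over [0], so [G] is the graph of a function, whose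
    linearity follows. Maps can thus be given by a specification instead of a formula. *)
Lemma graph_linear (R : pzRingType) (U V : lmodType R) (G : U -> V -> Prop) :
    (forall x, exists y, G x y) ->
    (forall a x y x' y', G x y -> G x' y' -> G (a *: x + x') (a *: y + y')) ->
    (forall y, G 0 y -> y = 0) ->
  exists f : {linear U -> V}, forall x, G x (f x).
Proof.
move=> tot lin fun0; pose f x := sval (cid (tot x)).
have Gf x : G x (f x) by rewrite /f; case: (cid _).
have uniq x y y' : G x y -> G x y' -> y = y'.
  move=> Gy Gy'; apply/esym/subr0_eq/fun0.
  by have := lin (-1) _ _ _ _ Gy Gy'; rewrite !scaleN1r addNr addrC.
have flin : linear f.
  by move=> a x y; apply: uniq (Gf _) _; apply: lin; apply: Gf.
pose fL := GRing.isLinear.Build _ _ _ _ f flin.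
by exists (HB.pack f fL : {linear U -> V}).
Qed.

Lemma isomorphic_of_bij (R : pzRingType) (U V : lmodType R)
    (f : {linear U -> V}) :
  (forall x, f x = 0 -> x = 0) -> (forall y, exists x, f x = y) ->
  isomorphic_modules U V.
Proof.
move=> f0 fs; exists f; pose g y := sval (cid (fs y)).
have fg y : f (g y) = y by rewrite /g; case: (cid _).
exists g => // x; apply/subr0_eq/f0.
by rewrite linearB /= fg subrr.
Qed.

(** * Fully invariant summands and central idempotents *)

Section Submodules.
Variables (R : pzRingType) (M : lmodType R).
Implicit Types (A : set M) (f g h e : {linear M -> M}).

Lemma submoduleP A :
  submodule A <-> A 0 /\ forall a x y, A x -> A y -> A (a *: x + y).
Proof.
split=> [[/set_mem A0 AD]|[A0 AD]]; split=> //.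
- by move=> a x y Ax Ay; apply/set_mem/AD; apply/mem_set.
- exact/mem_set.
- by move=> a x y /set_mem Ax /set_mem Ay; apply/mem_set/AD.
Qed.

Lemma submod0 A : submodule A -> A 0. Proof. by case/submoduleP. Qed.

Lemma submodZD A a x y : submodule A -> A x -> A y -> A (a *: x + y).
Proof. by case/submoduleP=> _; apply. Qed.

Arguments submodZD {A a x y}.

Lemma submodZ A a x : submodule A -> A x -> A (a *: x).
Proof. by move=> sA Ax; rewrite -[_ *: _]addr0; exact: (submodZD sA Ax (submod0 sA)). Qed.

Arguments submodZ {A a x}.

Lemma submodD A x y : submodule A -> A x -> A y -> A (x + y).
Proof. by move=> sA Ax Ay; rewrite -[x]scale1r; apply: submodZD. Qed.

Lemma submodB A x y : submodule A -> A x -> A y -> A (x - y).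
Proof.
by move=> sA Ax Ay; rewrite addrC -scaleN1r; apply: submodZD.
Qed.

Definition central e := forall h x, h (e x) = e (h x).

Lemma ker_submodule f : submodule (f @^-1` [set 0]).
Proof.
apply/submoduleP; split=> /= [|a x y fx fy]; first exact: linear0.
by rewrite linearP fx fy scaler0 addr0.
Qed.

Lemma range_submodule f : submodule (range f).
Proof.
apply/submoduleP; split=> [|a _ _ [x _ <-] [y _ <-]].
  by exists 0 => //; rewrite linear0.
by exists (a *: x + y) => //; rewrite linearP.
Qed.

(** The decomposition [x = (x - e x) + e x] splits [M], and centrality makes both summands invariant
    under every endomorphism. This is the way back from [ssr_strongly_regular]. *)
Lemma central_idem_ssr :
  (forall f, exists e, [/\ central e, forall x, e (e x) = e x,
     forall x, f x = 0 <-> e x = 0 & forall y, range f y <-> e y = y]) ->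
  strongly_self_regular M.
Proof.
move=> H f; have [e [ce ee ke re]] := H f.
have kE : f @^-1` [set 0] = [set x | e x = 0] by apply/seteqP; split=> x /ke.
have rE : range f = [set x | e x = x] by apply/seteqP; split=> x /re.
have sk : submodule [set x | e x = 0] by rewrite -kE; apply: ker_submodule.
have sr : submodule [set x | e x = x] by rewrite -rE; apply: range_submodule.
have dj : [set x | e x = 0] `&` [set x | e x = x] = [set 0].
  apply/seteqP; split=> x /=; first by case=> e0 <-.
  by move->; rewrite linear0.
have e1 x : e (x - e x) = 0 by rewrite linearB /= ee subrr.
split; rewrite ?kE ?rE.
- split=> //; exists [set x | e x = x]; split=> //.
  apply/seteqP; split=> // x _; exists (x - e x) => /=; first exact: e1.
  by exists (e x) => //=; rewrite subrK.
- by move=> h _ [x /= ex <-]; rewrite -ce ex linear0.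
- split=> //; exists [set x | e x = 0]; split; rewrite 1?setIC //.
  apply/seteqP; split=> // x _; exists (e x) => //.
  by exists (x - e x) => /=; [exact: e1 | rewrite addrC subrK].
- by move=> h _ [x /= ex <-]; rewrite -ce ex.
Qed.

(* The kernel of the projection [e] is fully invariant, being the kernel of an
   endomorphism, so both summands are and [e] is central. *)
Lemma summand_projection A : strongly_self_regular M ->
    direct_summand A -> fully_invariant A ->
  exists e, [/\ central e, forall x, e (e x) = e x & forall x, A x <-> e x = x].
Proof.
move=> ssr [sA [B [sB AB AB1]]] fA.
have dj x : A x -> B x -> x = 0 by move=> Ax Bx; rewrite -[x = 0]/([set 0] x) -AB.
have [e eP] : exists e, forall x, A (e x) /\ B (x - e x).
  apply: (@graph_linear _ _ _ (fun x y => A y /\ B (x - y))).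
  - move=> x; have : setT x by []. 
    by rewrite -AB1 => -[y Ay [z Bz <-]]; exists y; rewrite addrC addKr.
  - move=> a x y x' y' [Ay Bxy] [Ay' Bxy']; split; first exact: submodZD.
    by rewrite opprD addrACA -scalerBr; apply: submodZD.
  - move=> y [Ay By]; apply: dj => //; rewrite -[y]opprK -scaleN1r.
    by apply: submodZ => //; rewrite -[- y]add0r.
have eA x : A x <-> e x = x.
  split=> [Ax|<-]; last by case: (eP x).
  apply/esym/subr0_eq/dj; last by case: (eP x).
  by apply: submodB => //; case: (eP x).
have ee x : e (e x) = e x by apply/eA; case: (eP x).
exists e; split=> // h x.
have [_ fk _ _] := ssr e.
have hA y : A y -> A (h y) by move=> Ay; apply: (fA h); exists y.
have /eqP : e (h (x - e x)) = 0.
  by apply: (fk h); exists (x - e x) => //=; rewrite linearB /= ee subrr.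
rewrite !linearB /= subr_eq0 => /eqP ->.
by apply/esym/eA/hA; case: (eP x).
Qed.

(** The projection [k] onto the kernel commutes with [f], so [k (f u) = f (k u) = 0]: kernel and
    image meet in [0]. As also [f (e x) = f x], the map [f] is bijective on its image; [g] is [e]
    followed by the inverse there. *)
Lemma ssr_strongly_regular f : strongly_self_regular M ->
  exists e g, [/\ central e, forall x, e (e x) = e x, forall x, f (g x) = e x,
                  forall x, g (f x) = e x & forall x, e (f x) = f x].
Proof.
move=> ssr; have [dk fk dr fr] := ssr f.
have [k [ck kk kP]] := summand_projection ssr dk fk.
have [e [ce ee eP]] := summand_projection ssr dr fr.
have ef x : e (f x) = f x by apply/eP; exists x.
have fk0 x : f (k x) = 0 by apply/kP.
have fe x : f (e x) = f x by rewrite ce ef.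
have ke x : k (e x) = 0.
  have [u _ <-] : range f (e x) by apply/eP.
  by rewrite -ck fk0.
have fe0 x : f x = 0 -> e x = 0.
  move=> fx0; have /kP : f (e x) = 0 by rewrite fe.
  by rewrite ke => <-.
have [g gP] : exists g, forall x, e (g x) = g x /\ f (g x) = e x.
  apply: (@graph_linear _ _ _ (fun x y => e y = y /\ f y = e x)).
  - move=> x; have [u _ uE] : range f (e x) by apply/eP.
    by exists (e u); rewrite ee fe.
  - by move=> a x y x' y' [ey fy] [ey' fy']; rewrite !linearP ey fy ey' fy'.
  - by move=> y [ey fy]; rewrite -ey fe0 // fy linear0.
exists e, g; split=> // x; first by case: (gP x).
apply/subr0_eq; have [eg _] := gP (f x); rewrite -eg -linearB.
apply: fe0; rewrite linearB /=; have [_ ->] := gP (f x).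
by rewrite ef subrr.
Qed.

(** With [g] from the previous lemma, [f x = g (f (f x))]. *)
Lemma ssr_reduced f : strongly_self_regular M ->
  forall x, f (f x) = 0 -> f x = 0.
Proof.
move=> ssr x ffx; have [e [g [_ _ _ gf ef]]] := ssr_strongly_regular f ssr.
by rewrite -ef -gf ffx linear0.
Qed.

End Submodules.

Arguments submodZD {R M A a x y}.
Arguments submodZ {R M A a x}.

(** * Zorn's lemma and Noetherian rings *)

(** [Zorn_bigcup] also asks about the empty chain. Passing to the sets [A] with [A0] adjoined in [F]
    turns that case into [F A0]. *)
Lemma Zorn_above (T : Type) (F : set (set T)) (A0 : set T) : F A0 ->
    (forall C : set (set T), C !=set0 -> C `<=` F -> total_on C subset ->
       F (\bigcup_(X in C) X)) ->
  exists A, [/\ F A, A0 `<=` A & forall B, F B -> A `<=` B -> B = A].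
Proof.
move=> F0 FU; have [|A [FA Amax]] := @Zorn_bigcup T [set A | F (A `|` A0)].
  move=> C CF Ctot /=; have [->|/set0P[X CX]] := eqVneq C set0.
    by rewrite bigcup_set0 set0U.
  suff -> : \bigcup_(X in C) X `|` A0 =
            \bigcup_(Y in [set X `|` A0 | X in C]) Y.
    apply: FU; first by exists (X `|` A0), X.
      by move=> _ [Y CY <-]; apply: CF.
    move=> _ _ [Y CY <-] [Z CZ <-].
    by case: (Ctot _ _ CY CZ) => YZ; [left|right]; apply: setSU.
  apply/seteqP; split=> t.
    case=> [[Y CY Yt]|A0t]; last by exists (X `|` A0); [exists X|right].
    by exists (Y `|` A0); [exists Y|left].
  by case=> _ [Y CY <-] [Yt|]; [left; exists Y|right].
exists (A `|` A0); split=> // B FB AB; apply/seteqP; split=> // t Bt.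
have A0B : A0 `<=` B by move=> u A0u; apply: AB; right.
apply: contrapT => nAt; apply: (Amax B); last by rewrite /= setUidl.
by split=> [u Au|BA]; [apply: AB; left | apply: nAt; left; apply: BA].
Qed.

Lemma bigcup_chain_submodule (R : pzRingType) (M : lmodType R)
    (C : set (set M)) : C !=set0 -> C `<=` @submodule R M ->
  total_on C subset -> submodule (\bigcup_(X in C) X).
Proof.
move=> [X CX] Csub Ctot; apply/submoduleP; split.
  by exists X => //; apply: (submod0 (Csub _ CX)).
move=> a x y [Y CY Yx] [Z CZ Zy].
case: (Ctot _ _ CY CZ) => YZ.
  by exists Z => //; apply: (submodZD (Csub _ CZ) _ Zy); apply: YZ.
by exists Y => //; apply: (submodZD (Csub _ CY) Yx _); apply: YZ.
Qed.

(** Ideals are handled as submodules of [R^o]; terms of [idealr] are proper, whence [~ A 1]. *)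
Lemma idealrP (R : comNzRingType) (A : set R^o) : submodule A -> ~ A 1 ->
  exists J : idealr R, forall x, x \in J <-> A x.
Proof.
move=> sA A1; pose S : pred R := fun x => `[<A x>].
have Scl : idealr_closed S.
  split; rewrite ?unfold_in.
  - by apply/asboolP; exact: submod0 sA.
  - exact/asboolPn.
  - by move=> a x y /asboolP Ax /asboolP Ay; apply/asboolP; apply: submodZD.
pose iS := isIdealr.Build R S Scl.
by exists (HB.pack S iS : idealr R) => x; split=> [/asboolP|Ax]; last exact/asboolP.
Qed.

Lemma prime_idealrP (R : comNzRingType) (A : set R^o) : submodule A -> ~ A 1 ->
    (forall x y : R, A (x * y) -> A x \/ A y) ->
  exists J : prime_idealr R, forall x, x \in J <-> A x.
Proof.
move=> sA A1 prA; have [J JP] := idealrP sA A1.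
have Jcl : prime_idealr_closed J.
  by move=> x y /JP/prA[] /JP ->; rewrite ?orbT.
pose iJ := isPrimeIdealrClosed.Build R J Jcl.
by exists (HB.pack (J : pred R) J iJ : prime_idealr R) => x; apply: JP.
Qed.

(** Finite generation is restated as a test on generators, so that later uses need no linear
    combinations. *)
Lemma noetherian_generators (R : comNzRingType) (J : idealr R) :
    noetherian_ring R ->
  exists s : seq R, {subset s <= J} /\
    forall A : set R^o, submodule A -> (forall a, a \in s -> A a) ->
      forall x, x \in J -> A x.
Proof.
move=> /(_ J)[s sP]; exists s; split=> [a as_|A sA As x /sP[c ->]].
  have lt_as : (index a s < size s)%N by rewrite index_mem.
  apply/sP; exists (fun i => (i == Ordinal lt_as)%:R).
  rewrite (bigD1 (Ordinal lt_as)) //= eqxx mul1r nth_index // big1 ?addr0 //.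
  by move=> i /negPf ->; rewrite mul0r.
elim/big_rec: _ => [|i y _ Ay]; first exact: submod0 sA.
by apply: (@submodZD R R^o) => //; apply: As; rewrite mem_nth.
Qed.

(** The union of a chain is a proper ideal; its finitely many generators already lie in one member
    of the chain, which is therefore the whole union. *)
Lemma noetherian_maximal (R : comNzRingType) (F : set (set R^o)) :
    noetherian_ring R -> (forall A, F A -> submodule A /\ ~ A 1) ->
    F !=set0 ->
  exists A, F A /\ forall B, F B -> A `<=` B -> B = A.
Proof.
move=> noeth Fid [A0 FA0].
have [|A [FA _ Amax]] := Zorn_above FA0; last by exists A.
move=> C [X0 CX0] CF Ctot; set U := \bigcup_(X in C) X.
have sU : submodule U.
  apply: bigcup_chain_submodule => //; first by exists X0.
  by move=> X /CF/Fid[].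
have U1 : ~ U 1 by case=> X /CF/Fid[].
have [J JP] := idealrP sU U1; have [s [sJ Js]] := noetherian_generators J noeth.
have [X CX sX] : exists2 X, C X & forall a, a \in s -> X a.
  elim: s {Js} sJ => [|a s IHs] sJ; first by exists X0.
  have [X CX sX] : exists2 X, C X & forall a, a \in s -> X a.
    by apply: IHs => b bs; apply: sJ; rewrite inE bs orbT.
  have [Y CY Ya] : U a by apply/JP/sJ; rewrite inE eqxx.
  have [XY|YX] := Ctot _ _ CX CY.
    by exists Y => // b; rewrite inE => /predU1P[->|/sX/XY].
  by exists X => // b; rewrite inE => /predU1P[->|/sX //]; apply: YX.
suff -> : U = X by apply: CF.
apply/seteqP; split=> [x /JP Jx|x Xx]; last by exists X.
by apply: Js Jx => //; have [] := Fid _ (CF _ CX).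
Qed.

(** [J] is an associated prime of [M / N]: a maximal member among the ideals [colon r]. If it
    contains [a * b] but not [b], then [colon (b * r)] contains it, so equals it by maximality, and
    contains [a]. *)
Lemma exists_associated_prime (R : comNzRingType) (M : lmodType R)
    (N : set M) (x : M) :
    noetherian_ring R -> submodule N -> ~ N x ->
  exists r (J : prime_idealr R),
    ~ N (r *: x) /\ forall a, a \in J <-> N (a *: (r *: x)).
Proof.
move=> noeth sN Nx.
pose colon r : set R^o := [set a | N (a *: (r *: x))].
have colon_sub r : submodule (colon r).
  apply/submoduleP; split=> [|a b c Nb Nc] /=.
    by rewrite /colon /= scale0r; apply: submod0.
  by rewrite /colon /= scalerDl -[_ *: b]/(a * b) -scalerA; apply: submodZD.
have [||_ [[r rx <-] rmax]] :=
  @noetherian_maximal R [set colon r | r in [set r | ~ N (r *: x)]] noeth.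
- by move=> _ [r rx <-]; split=> //; rewrite /colon /= scale1r.
- by exists (colon 1), 1 => //=; rewrite scale1r.
have [||a b abx|J JP] := @prime_idealrP R (colon r) => //.
- by rewrite /colon /= scale1r.
- have [|nb] := pselect (colon r b); [by right | left].
  suff <- : colon (b * r) = colon r.
    by move: abx; rewrite /colon /= !scalerA mulrA.
  apply: rmax; first by exists (b * r) => //=; rewrite -scalerA.
  move=> c cx; have E : c *: (b * r *: x) = b *: (c *: (r *: x)).
    by rewrite !scalerA mulrCA mulrA.
  by rewrite /colon /= E; apply: (submodZ sN cx).
- by exists r, J; split.
Qed.

(** * The socle and its components killed by maximal ideals *)

Section Socle.
Variables (R : comNzRingType) (M : lmodType R).
Implicit Types (P J : idealr R) (N L : set M).

Definition killed_by P (x : M) := forall a, a \in P -> a *: x = 0.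

(** The sum of all simple submodules, encoded as a least submodule: membership is then itself an
    induction principle. *)
Definition socle : set M :=
  [set x | forall L, submodule L ->
     (forall P, maximal_ideal P -> killed_by P `<=` L) -> L x].

Lemma socle_submodule : submodule socle.
Proof.
apply/submoduleP; split=> [|a x y sx sy] L sL PL; first exact: submod0 sL.
by apply: (submodZD sL _ _); [apply: sx | apply: sy].
Qed.

Lemma killed_by_socle P : maximal_ideal P -> killed_by P `<=` socle.
Proof. by move=> mP x Px L _ PL; exact: (PL P mP). Qed.

Lemma socle_stable (h : {linear M -> M}) x : socle x -> socle (h x).
Proof.
move=> sx; apply: (sx [set y | socle (h y)]) => [|P mP y Py].
  apply/submoduleP; split=> /= [|a y z hy hz].
    by rewrite linear0; apply: (submod0 socle_submodule).
  by rewrite linearP; apply: (submodZD socle_submodule _ _).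
by apply: (killed_by_socle mP) => a /Py ay; rewrite -linearZ /= ay linear0.
Qed.

Lemma maximal_ideal_inv P a : maximal_ideal P -> a \notin P ->
  exists b, 1 - b * a \in P.
Proof.
(* This is the ideal [P + R a]; were it proper, it would equal [P] and contain [a]. *)
move=> mP aP; pose A : set R^o := [set x | exists b, x - b * a \in P].
have sA : submodule A.
  apply/submoduleP; split; first by exists 0; rewrite mul0r subr0 idealr0.
  move=> c x y [b xb] [d yd]; exists (c * b + d).
  rewrite [c *: x]/(c * x) mulrDl opprD addrACA -mulrA -mulrBr.
  by rewrite rpredD // idealMr.
have [//|A1] := pselect (A 1).
have [J JA] := idealrP sA A1.
have /mP JP : {subset P <= J}.
  by move=> x Px; apply/JA; exists 0; rewrite mul0r subr0.
by case/negP: aP; rewrite -JP; apply/JA; exists 1; rewrite mul1r subrr idealr0.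
Qed.

Lemma killed_by_inv P a (x : M) : maximal_ideal P -> killed_by P x ->
  a \notin P -> exists b, b *: (a *: x) = x.
Proof.
move=> mP Px /(maximal_ideal_inv mP)[b /Px].
by rewrite scalerBl scale1r -scalerA => /subr0_eq xE; exists b.
Qed.

Hypothesis ssrM : strongly_self_regular M.

(* For one scalar [a], [p] is the projection onto the kernel of [a] in the
   decomposition of [M] into kernel and image of [a]; on the image, [a] is
   inverted by an endomorphism, which preserves [N]. *)
Lemma annihilator_projection (s : seq R) : exists p : {linear M -> M},
  [/\ central p, forall x a, a \in s -> a *: p x = 0,
      forall x, (forall a, a \in s -> a *: x = 0) -> p x = x
    & forall N, submodule N -> (forall (h : {linear M -> M}) x, N x -> N (h x)) ->
      forall x, (forall a, a \in s -> N (a *: x)) -> N (x - p x)].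
Proof.
elim: s => [|a s [p [cp sp ps Np]]].
  exists idfun; split=> // N sN _ x _; rewrite subrr; exact: submod0 sN.
have [e [g [ce ee ag ga ea]]] := ssr_strongly_regular ( *:%R a) ssrM.
(* [idfun \- e] projects onto the kernel of [a]; composing intersects it with the annihilator of
   [s]. *)
pose q : {linear M -> M} := p \o (idfun \- e).
have aq x : a *: (x - e x) = 0 by rewrite scalerBr -linearZ ea subrr.
exists q; rewrite /q; split=> /= [h x|x b|x sx|N sN hN x sx].
- by rewrite cp linearB ce.
- rewrite inE => /predU1P[->|]; last exact: sp.
  by rewrite -linearZ /= aq linear0.
- have ex0 : e x = 0 by rewrite -ga /= sx ?inE ?eqxx // linear0.
  by rewrite ex0 subr0 ps // => b bs; rewrite sx // inE bs orbT.
- have Nex : N (e x) by rewrite -ga /=; apply: hN; apply: sx; rewrite inE eqxx.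
  rewrite -(subrKA (x - e x)); apply: (submodD sN _ _).
    by rewrite opprB addrCA subrr addr0.
  apply: Np => // b bs; rewrite scalerBr -linearZ.
  by apply: (submodB sN _ _); [|apply: (hN e)]; apply: sx; rewrite inE bs orbT.
Qed.

(** Otherwise [M / socle] has an associated prime [J], the colon ideal of some [r *: x], and [J] is
    maximal. The projection [p] to the part killed by [J] sends [r *: x] into the socle, and the
    difference lies there because [J] maps [r *: x] into the socle. *)
Lemma socle_full : noetherian_ring R ->
  (forall (J : prime_idealr R) (x : M),
     (forall a, a *: x = 0 -> a \in J) -> maximal_ideal J) ->
  forall x, socle x.
Proof.
move=> noeth H x; apply: contrapT => nx.
have [r [J [nrx JP]]] := exists_associated_prime noeth socle_submodule nx.
have mJ : maximal_ideal J.
  apply: (H J (r *: x)) => a ax; apply/JP; rewrite ax.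
  exact: submod0 socle_submodule.
have [s [sJ Js]] := noetherian_generators J noeth.
have [p [_ sp _ Np]] := annihilator_projection s.
apply: nrx; rewrite -[r *: x](subrK (p (r *: x))).
apply: (submodD socle_submodule _ _).
  by apply: (Np _ socle_submodule socle_stable) => a /sJ /JP.
apply: (killed_by_socle mJ) => a; apply: (Js [set b | b *: p (r *: x) = 0]).
  apply/submoduleP; split=> /= [|b c d cx dx]; first by rewrite scale0r.
  by rewrite scalerDl dx -scalerA cx scaler0 addr0.
by move=> b; apply: sp.
Qed.

(** Being killed by [P] can be tested on finitely many generators. *)
Lemma maximal_projection P : noetherian_ring R -> exists p : {linear M -> M},
  [/\ central p, forall x, killed_by P (p x)
    & forall x, killed_by P x -> p x = x].
Proof.
move=> noeth; have [s [sP Ps]] := noetherian_generators P noeth.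
have [p [cp sp ps _]] := annihilator_projection s.
exists p; split=> // x; last by move=> Px; apply: ps => a /sP; apply: Px.
move=> a; apply: (Ps [set b | b *: p x = 0]); last by move=> b; apply: sp.
apply/submoduleP; split=> /= [|b c d cx dx]; first by rewrite scale0r.
by rewrite scalerDl dx -scalerA cx scaler0 addr0.
Qed.

(* Otherwise a hyperplane [L] through [y] avoiding [m] yields the nonzero
   nilpotent endomorphism sending [m] to [y] and [L] to [0]. *)
Lemma killed_by_rank1 P (m y : M) : noetherian_ring R -> maximal_ideal P ->
  killed_by P m -> killed_by P y -> m != 0 -> exists r, y = r *: m.
Proof.
move=> noeth mP Pm Py m0; apply: contrapT => ny.
have y0 : y <> 0 by move=> y0; apply: ny; exists 0; rewrite y0 scale0r.
pose F : set (set M) := [set L | [/\ submodule L, L y & ~ L m]].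
have spanS L z : submodule L ->
    submodule [set x | exists l r, L l /\ x = l + r *: z].
  move=> sL; apply/submoduleP; split.
    by exists 0, 0; rewrite scale0r addr0; split=> //; apply: (submod0 sL).
  move=> a _ _ [l [r [Ll ->]]] [k [t [Lk ->]]].
  exists (a *: l + k), (a * r + t); split; first exact: submodZD sL _ _.
  by rewrite scalerDr scalerDl -scalerA addrACA.
(* The start is [R y], written as [[set 0]] plus multiples of [y] to reuse [spanS]. *)
have [||L [[sL Ly Lm] _ Lmax]] :=
  @Zorn_above M F [set x | exists l r, ([set 0] : set M) l /\ x = l + r *: y].
- split.
  + apply: spanS; apply/submoduleP.
    by split=> //= a _ _ -> ->; rewrite scaler0 addr0.
  + by exists 0, 1; rewrite scale1r add0r.
  + move=> [_ [r [-> mr]]]; rewrite add0r in mr.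
    have rP : r \notin P by apply/negP => /Py ry; rewrite mr ry eqxx in m0.
    have [b by_] := killed_by_inv mP Py rP.
    by apply: ny; exists b; rewrite mr by_.
- move=> C C0 CF Ctot; split.
  + by apply: bigcup_chain_submodule => // X /CF[].
  + by have [X CX] := C0; exists X => //; have [] := CF _ CX.
  + by case=> X /CF[].
(* Modulo [L], what [P] kills is the line through [m]: for [z] outside [L], maximality puts [m] in
   [L + R z], with a coefficient of [z] invertible modulo [P]. *)
have Lspan z : killed_by P z -> exists r, L (z - r *: m).
  move=> Pz; have [Lz|Lz] := pselect (L z).
    by exists 0; rewrite scale0r subr0.
  pose L' : set M := [set x | exists l r, L l /\ x = l + r *: z].
  have sL' : submodule L' by apply: spanS.
  have LL' : L `<=` L' by move=> l Ll; exists l, 0; rewrite scale0r addr0.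
  have L'z : L' z.
    by exists 0, 1; rewrite scale1r add0r; split=> //; apply: (submod0 sL).
  have [[l [r [Ll mlr]]]|L'm] := pselect (L' m); last first.
    case: Lz; suff <- : L' = L by [].
    by apply: Lmax => //; split=> //; apply: LL'.
  have rP : r \notin P.
    apply/negP => /Pz rz; apply: Lm.
    by rewrite mlr rz addr0.
  have [b bz] := killed_by_inv mP Pz rP.
  exists b; have -> : z - b *: m = (- b) *: l.
    by rewrite mlr scalerDr bz opprD addrCA subrr addr0 scaleNr.
  exact: (submodZ sL Ll).
have Lmul r : L (r *: m) -> r \in P.
  move=> Lrm; apply: contraPT Lm => rP; apply; move: Lrm.
  have [b {2}<-] := killed_by_inv mP Pm rP; exact: (submodZ sL).
have [p [_ Pp pP]] := maximal_projection P noeth.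
(* The coefficient [r] is determined modulo [P] only, by [Lmul]; this suffices as [P] kills [y]. *)
have [h hP] : exists h : {linear M -> M},
    forall x, exists r, L (p x - r *: m) /\ h x = r *: y.
  apply: (@graph_linear _ _ _ (fun x w => exists r, L (p x - r *: m) /\ w = r *: y)).
  - by move=> x; have [r Lr] := Lspan _ (Pp x); exists (r *: y), r.
  - move=> a x _ x' _ [r [Lr ->]] [r' [Lr' ->]]; exists (a * r + r').
    rewrite linearP !scalerDl -!scalerA opprD addrACA -scalerBr.
    by split=> //; apply: (submodZD sL _ _).
  - move=> _ [r [Lr ->]]; apply: Py; apply: Lmul.
    rewrite linear0 sub0r in Lr.
    by rewrite -[_ *: m]opprK -scaleN1r; apply: (submodZ sL Lr).
have hm : h m = y.
  have [r [Lr ->]] := hP m; rewrite (pP _ Pm) in Lr.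
  apply/esym/subr0_eq; rewrite -{1}(scale1r y) -scalerBl; apply: Py.
  by apply: Lmul; rewrite scalerBl scale1r.
have hy : h y = 0.
  have [r [Lr ->]] := hP y; rewrite (pP _ Py) in Lr.
  apply: Py; apply: Lmul; rewrite -(subKr y (r *: m)).
  exact: (submodB sL).
by apply: y0; rewrite -hm; apply: ssr_reduced => //; rewrite hm.
Qed.

End Socle.

(** * Quotients [R / P] and coordinates on direct sums *)

Lemma finite_set_induction (T : Type) (Q : set T -> Prop) :
    Q set0 -> (forall x A, Q A -> Q (x |` A)) ->
  forall A, finite_set A -> Q A.
Proof.
elim/Pchoice: T => T in Q *; move=> Q0 QU A /finite_seqP[s ->].
elim: s => [|x s IHs].
  by suff -> : [set` [::]] = set0 :> set T by []; apply/seteqP; split.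
suff -> : [set` x :: s] = x |` [set` s] by apply: QU.
by apply/seteqP; split=> y /=; rewrite inE => /predU1P.
Qed.

Section QuotientProjection.
Variables (R : comNzRingType) (P : idealr R).

(* Packaged as [lmodType]s, so that no coercion has to be inferred back. *)
Definition quot_lmod : lmodType R := quot_module P.

Definition quot_proj (r : R) : quot_lmod := \pi_({ideal_quot P}) r.

Lemma quot_proj_lin a r s :
  quot_proj (a * r + s) = a *: quot_proj r + quot_proj s.
Proof. by rewrite /quot_proj rmorphD rmorphM. Qed.

Lemma quot_projZ a r : quot_proj (a * r) = a *: quot_proj r.
Proof. by rewrite /quot_proj rmorphM. Qed.

Lemma quot_proj_eq0 r : quot_proj r = 0 <-> r \in P.
Proof.
rewrite -[r in r \in P]subr0 Quotient.idealrBE; split=> [E|/eqP E].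
  by apply/eqP; rewrite [LHS]E; rewrite rmorph0.
by rewrite /quot_proj E rmorph0.
Qed.

Lemma quot_proj_surj (y : quot_lmod) : exists r, quot_proj r = y.
Proof. by exists (repr (y : {ideal_quot P})); rewrite /quot_proj reprK. Qed.

Lemma quot_lmod_killed (a : R) (y : quot_lmod) : a \in P -> a *: y = 0.
Proof.
have [r <-] := quot_proj_surj y => Pa.
by rewrite -quot_projZ; apply/quot_proj_eq0; rewrite mulrC idealMr.
Qed.

End QuotientProjection.

Section DirectSum.
Variables (R : pzRingType) (I : Type) (V : I -> lmodType R).

Definition dsum_lmod : lmodType R := direct_sum V.
Implicit Types d : dsum_lmod.

Definition coord i d : V i := direct_sum_val (d : direct_sum V) i.

Fact coord_linear i : linear (coord i).
Proof. by []. Qed.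

HB.instance Definition _ i :=
  GRing.isLinear.Build R dsum_lmod (V i) _ (coord i) (coord_linear i).

Lemma coord_ext d d' : (forall i, coord i d = coord i d') -> d = d'.
Proof. by move=> dd'; apply/val_inj/functional_extensionality_dep. Qed.

Lemma coord_finite d : finite_set [set i | coord i d != 0].
Proof. by rewrite /coord; case: d => v /= /asboolP. Qed.

Lemma direct_sumP (v : forall i, V i) (A : set I) : finite_set A ->
  (forall i, v i <> 0 -> A i) -> exists d, forall i, coord i d = v i.
Proof.
move=> finA vA; have fv : (v : direct_product V) \in @fin_supported _ _ V.
  by apply/asboolP; apply: sub_finite_set finA => i /= /eqP /vA.
by exists (DirectSum fv : direct_sum V).
Qed.

End DirectSum.

(** * Decomposition into quotients by maximal ideals *)

Section Structure.
Variables (R : comNzRingType) (M : lmodType R).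
Hypothesis noeth : noetherian_ring R.
Hypothesis ssrM : strongly_self_regular M.

(** A scalar in [Q] outside [P] would kill [x] and yet act invertibly on it. *)
Lemma maximal_killed_eq (P Q : idealr R) (x : M) :
  maximal_ideal P -> maximal_ideal Q -> killed_by P x -> killed_by Q x ->
  x <> 0 -> Q =i P.
Proof.
move=> mP mQ Px Qx x0; suff /mQ QP : {subset Q <= P} by move=> a; rewrite QP.
move=> a Qa; apply/negPn/negP => /(killed_by_inv mP Px)[b].
by rewrite (Qx _ Qa) scaler0 => /esym.
Qed.

(** [phi] is the projection to the part killed by [P], which is [R m] by [killed_by_rank1], followed
    by [r *: m |-> r] modulo [P]. *)
Lemma exists_coordinate (P : idealr R) (m : M) :
  maximal_ideal P -> killed_by P m -> m != 0 ->
  exists phi : {linear M -> quot_lmod P},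
   [/\ phi m = quot_proj P 1,
       forall (Q : idealr R) x,
         maximal_ideal Q -> killed_by Q x -> phi x <> 0 -> Q =i P
     & forall x, killed_by P x -> phi x = 0 -> x = 0].
Proof.
move=> mP Pm /eqP m0.
have [p [cp Pp pP]] := maximal_projection ssrM P noeth.
have unitP r : r *: m = 0 -> r \in P.
  move=> rm; apply: contra_notT m0 => rP.
  by have [b <-] := killed_by_inv mP Pm rP; rewrite rm scaler0.
have [phi phiP] : exists phi : {linear M -> quot_lmod P},
    forall x, exists r, p x = r *: m /\ phi x = quot_proj P r.
  apply: (@graph_linear _ _ _
    (fun x w => exists r, p x = r *: m /\ w = quot_proj P r)).
  - move=> x; have [|||||r rE] := @killed_by_rank1 _ _ ssrM P m (p x) => //.
      exact/eqP.
    by exists (quot_proj P r), r.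
  - move=> a x _ x' _ [r [pr ->]] [r' [pr' ->]]; exists (a * r + r').
    by rewrite linearP pr pr' quot_proj_lin scalerDl scalerA.
  - move=> _ [r [pr ->]]; apply/quot_proj_eq0/unitP.
    by rewrite -pr linear0.
exists phi; split.
- have [r [pr ->]] := phiP m; apply/subr0_eq.
  rewrite addrC -scaleN1r -quot_proj_lin; apply/quot_proj_eq0/unitP.
  by rewrite mulr1 scalerDl -pr scaleN1r pP // addNr.
- move=> Q x mQ Qx phix.
  apply: (@maximal_killed_eq P Q (p x)) => // [a /Qx ax|px0].
    by rewrite -linearZ /= ax linear0.
  apply: phix; have [r [pr ->]] := phiP x; apply/quot_proj_eq0/unitP.
  by rewrite -pr.
- move=> x Px; have [r [pr ->]] := phiP x => /quot_proj_eq0 /Pm rm.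
  by rewrite -(pP _ Px) pr.
Qed.

Hypothesis maxM : forall (J : prime_idealr R) (x : M),
  (forall a, a *: x = 0 -> a \in J) -> maximal_ideal J.

(** The coordinates [phi i] assemble to [Phi]. Finiteness of supports is checked on the socle, where
    an element killed by one maximal ideal has at most one nonzero coordinate. For injectivity, a
    nonzero [x] has a multiple whose annihilator is some [P i], and [phi i] detects it. *)
Lemma isomorphic_direct_sum (I : Type) (P : I -> idealr R) :
    (forall i, maximal_ideal (P i)) -> distinct_ideals P ->
    (forall i, exists2 m : M, m != 0 & killed_by (P i) m) ->
    (forall (Q : idealr R) (m : M), maximal_ideal Q -> killed_by Q m ->
       m <> 0 -> exists i, Q =i P i) ->
  isomorphic_modules M (dsum_lmod (fun i => quot_lmod (P i))).
Proof.
move=> mP dP exm cover.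
pose m i := sval (cid2 (exm i)).
have m0 i : m i != 0 by rewrite /m; case: cid2.
have Pm i : killed_by (P i) (m i) by rewrite /m; case: cid2.
pose phi i := sval (cid (exists_coordinate (mP i) (@Pm i) (m0 i))).
have phiP i : [/\ phi i (m i) = quot_proj (P i) 1,
       forall (Q : idealr R) x,
         maximal_ideal Q -> killed_by Q x -> phi i x <> 0 -> Q =i P i
     & forall x, killed_by (P i) x -> phi i x = 0 -> x = 0].
  by rewrite /phi; case: (cid _).
have fin x : finite_set [set i | phi i x <> 0].
  apply: (socle_full ssrM noeth maxM x (L := [set x | finite_set [set i | phi i x <> 0]])).
    apply/submoduleP; split=> /= [|a y z fy fz].
      apply: sub_finite_set (@finite_set0 I) => i /=.
      by rewrite linear0.
    apply: sub_finite_set (_ : finite_set ([set i | phi i y <> 0] `|`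
             [set i | phi i z <> 0])); last by rewrite finite_setU.
    move=> i /= nz; have [y0|] := pselect (phi i y = 0); last by left.
    by right=> z0; apply: nz; rewrite linearP y0 z0 scaler0 addr0.
  move=> Q mQ y Qy /=.
  have [[i yi]|no] := pselect (exists i, phi i y <> 0); last first.
    apply: sub_finite_set (@finite_set0 I) => i /= yi.
    by apply: no; exists i.
  apply: sub_finite_set (finite_set1 i) => j /= yj.
  have [_ /(_ Q y mQ Qy yi) Qi _] := phiP i.
  have [_ /(_ Q y mQ Qy yj) Qj _] := phiP j.
  by apply: dP => a; rewrite -Qi -Qj.
have [Phi PhiE] : exists Phi : {linear M -> dsum_lmod (fun i => quot_lmod (P i))},
    forall x i, coord i (Phi x) = phi i x.
  apply: (@graph_linear _ _ _ (fun x d => forall i, coord i d = phi i x)).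
  - move=> x; apply: (direct_sumP (fin x)) => i; exact.
  - by move=> a x d x' d' dE dE' i; rewrite !linearP /= dE dE'.
  - by move=> d dE; apply: coord_ext => i; rewrite dE linear0 linear0.
apply: (isomorphic_of_bij (f := Phi)) => [x Phix|d].
  apply: contrapT => x0.
  have [||r [J [rx JP]]] := @exists_associated_prime R M [set 0] x noeth => //.
    apply/submoduleP.
    by split=> //= a _ _ -> ->; rewrite scaler0 addr0.
  have mJ : maximal_ideal J by apply: (maxM (x := r *: x)) => a /JP.
  have Jrx : killed_by J (r *: x) by move=> a /JP.
  have [i Ji] := cover J _ mJ Jrx rx.
  have [_ _ phi0] := phiP i; apply: rx; apply: phi0.
    by move=> a; rewrite -Ji; apply: Jrx.
  by rewrite linearZ /= -PhiE Phix linear0.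
(* Surjectivity, by induction on a finite set containing the support of [d]: subtracting
   [Phi (r *: m i)] clears the coordinate [i] and leaves the others alone. *)
have: forall i, coord i d <> 0 -> [set i | coord i d != 0] i by move=> i /eqP.
have := coord_finite d; move: [set i | _] => A finA.
elim/finite_set_induction: A / finA d => [|i A IHA] d dA.
  exists 0; apply: coord_ext => i; rewrite linear0 linear0.
  by apply: contrapT => n0; apply: (dA i) => d0; apply: n0.
have [r rE] := quot_proj_surj (coord i d).
have [j|x xE] := IHA (d - Phi (r *: m i)).
  rewrite linearB /= PhiE linearZ /=; have [ji|ji] := pselect (j = i).
    rewrite ji; have [-> _ _] := phiP i.
    by rewrite -quot_projZ mulr1 rE subrr.
  have -> : phi j (m i) = 0.
    apply: contrapT => phij; apply: ji.
    have [_ /(_ (P i) (m i) (mP i) (@Pm i) phij) Pij _] := phiP j.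
    by apply: dP => a; rewrite Pij.
  by rewrite scaler0 subr0 => /dA [].
by exists (x + r *: m i); rewrite linearD /= xE subrK.
Qed.

End Structure.

(** * Transport along isomorphisms, and the fraction field *)

Lemma fraction_exists (R : idomainType) (x : {fraction R}) :
  exists d n : R, d != 0 /\ d%:F * x = n%:F.
Proof.
elim/quotW: x => x; exists (frac x).2, (frac x).1; split; first exact: denom_ratioP.
unlock FracField.tofrac; rewrite piE; apply/eqP; rewrite eqmodE.
rewrite /= FracField.equivfE /FracField.mulf !numden_Ratio ?mul1r ?oner_eq0 ?denom_ratioP //.
by rewrite mulr1 mulrC.
Qed.

(** Only the central idempotent and the partial inverse are conjugated; no summand has to be
    transported. *)
Lemma isomorphic_ssr (R : pzRingType) (M N : lmodType R) :
  isomorphic_modules M N -> strongly_self_regular N -> strongly_self_regular M.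
Proof.
move=> [f [g0 fK gK]] ssrN.
have [g gE] : exists g : {linear N -> M}, forall y, f (g y) = y.
  apply: (@graph_linear _ _ _ (fun y x => f x = y)) => [y|a x y x' y' <- <-|y fy].
  - by exists (g0 y).
  - by rewrite linearP.
  - by rewrite -[y]fK fy -(linear0 f) fK.
have gf x : g (f x) = x by rewrite -[g _]fK gE fK.
have finj x y : f x = f y -> x = y by move=> /(congr1 g0); rewrite !fK.
apply: central_idem_ssr => u.
pose v : {linear N -> N} := f \o (u \o g).
have [e [w [ce ee vw wv ev]]] := ssr_strongly_regular v ssrN.
pose e' : {linear M -> M} := g \o (e \o f).
exists e'; rewrite /e'; split=> [h x|x|x|y] /=.
- apply: finj; rewrite gE.
  have /= := ce (f \o (h \o g) : {linear N -> N}) (f x).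
  by rewrite gf.
- by rewrite gE ee.
- have vE : v (f x) = f (u x) by rewrite /v /= gf.
  split=> [ux|ex].
    by rewrite -wv vE ux !linear0.
  have e0 : e (f x) = 0 by rewrite -(gE (e _)) ex linear0.
  by apply: finj; rewrite linear0 -vE -ev -ce e0 linear0.
- split=> [[x _ <-]|eyE].
    have -> : f (u x) = v (f x) by rewrite /v /= gf.
    by rewrite ev /v /= gf gf.
  exists (g (w (f y))) => //; apply: finj.
  by have /= := vw (f y) => ->; rewrite -[in RHS]eyE gE.
Qed.

(** Clearing denominators, every endomorphism is multiplication by [f 1], hence zero or bijective;
    [e] is [0] or the identity accordingly. *)
Lemma fraction_module_ssr (R : idomainType) :
  strongly_self_regular (fraction_module R).
Proof.
apply: central_idem_ssr => f.
have fE (x : {fraction R}) : f x = x * (f 1 : {fraction R}).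
  have [d [n [d0 dx]]] := fraction_exists x.
  have dF0 : d%:F != 0 by rewrite tofrac_eq0.
  apply: (mulfI dF0).
  transitivity (f (d *: (x : fraction_module R)) : {fraction R}).
    by rewrite linearZ.
  transitivity (f (n *: (1 : fraction_module R)) : {fraction R}).
    congr (f _); rewrite -[LHS]/(d%:F * x) dx.
    by rewrite -[RHS]/(n%:F * 1) mulr1.
  by rewrite linearZ -[LHS]/(n%:F * _) -dx mulrA.
have [f1|f1] := eqVneq (f 1 : {fraction R}) 0.
  exists \0; split=> [h x|//|x|y] /=; rewrite ?linear0 //.
    by split=> // _; rewrite fE f1 mulr0.
  split=> [[x _ <-]|<-]; first by rewrite fE f1 mulr0.
  by exists 0; rewrite ?linear0.
exists idfun; split=> // [x|y] /=.
  split=> [/eqP|->]; last exact: linear0.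
  by rewrite fE mulf_eq0 (negPf f1) orbF => /eqP.
split=> // _; exists ((y : {fraction R}) / (f 1 : {fraction R})) => //.
by rewrite fE divfK.
Qed.

(** * Direct sums of simple modules with distinct annihilators *)

Section DirectSumOfSimples.
Variables (R : comNzRingType).

Lemma quot_lmod_generator (P : idealr R) (y z : quot_lmod P) :
  maximal_ideal P -> y <> 0 -> exists a, z = a *: y.
Proof.
have [r <-] := quot_proj_surj y; have [s <-] := quot_proj_surj z => mP r0.
have rP : r \notin P by apply/negP => /quot_proj_eq0.
have [b bP] := maximal_ideal_inv mP rP.
exists (s * b); apply/subr0_eq; rewrite -quot_projZ addrC -scaleN1r.
rewrite -quot_proj_lin; apply/quot_proj_eq0.
by rewrite mulN1r addrC -mulrA -{1}[s]mulr1 -mulrBr idealMr.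
Qed.

Lemma maximal_idealM (P : idealr R) a b :
  maximal_ideal P -> a \notin P -> b \notin P -> a * b \notin P.
Proof.
move=> mP /(maximal_ideal_inv mP)[c cP]; apply: contra => abP.
rewrite -[b]mul1r -(subrK (c * a) 1) mulrDl -mulrA.
by apply: rpredD; [rewrite mulrC|]; apply: idealMr.
Qed.

Variables (I : Type) (P : I -> idealr R) (V : I -> lmodType R).
Hypotheses (mP : forall i, maximal_ideal (P i)) (dP : distinct_ideals P).
Hypothesis killV : forall i (y : V i), killed_by (P i) y.
Hypothesis genV : forall i (y z : V i), y <> 0 -> exists a, z = a *: y.
Local Notation D := (dsum_lmod V).
Implicit Type d : D.

(** Distinct maximal ideals are not nested, so each [P j] has an element outside [P i]; the product
    of these stays outside [P i]. *)
Lemma exists_separating (A : set I) i : finite_set A -> ~ A i ->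
  exists2 a, a \notin P i & forall j, A j -> a \in P j.
Proof.
move: A; apply: finite_set_induction => [_|j A IHA nAi].
  by exists 1; rewrite ?idealr1.
have [a aPi aA] : exists2 a, a \notin P i & forall j, A j -> a \in P j.
  by apply: IHA => Ai; apply: nAi; right.
have [b [bj bi]] : exists b, b \in P j /\ b \notin P i.
  apply: contrapT => nob; apply: nAi; left; apply: dP => x.
  suff /mP E : {subset P j <= P i} by rewrite E.
  by move=> b bj; apply/negPn/negP => bi; apply: nob; exists b.
exists (b * a); first exact: maximal_idealM.
by move=> k [->|Ak]; [rewrite mulrC idealMr | rewrite idealMr ?aA].
Qed.

(* A scalar outside [P i] killing the finitely many other coordinates of [d]
   kills [f d] but acts injectively on [R / P i]. *)
Lemma endo_coord0 (f : {linear D -> D}) d i :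
  coord i d = 0 -> coord i (f d) = 0.
Proof.
move=> di0; have [||a aPi ad] := @exists_separating [set j | coord j d != 0] i.
- exact: coord_finite.
- by rewrite /= di0 eqxx.
have ad0 : a *: d = 0.
  apply: coord_ext => j; rewrite linearZ [RHS]linear0 /=.
  have [->|/eqP dj] := pselect (coord j d = 0); first by rewrite scaler0.
  by apply: killV; apply: ad.
have afd : a *: coord i (f d) = coord i (0 : D).
  by rewrite -[0](linear0 f) -ad0 linearZ.
have [b <-] := killed_by_inv (@mP i) (killV (coord i (f d))) aPi.
by rewrite afd linear0.
Qed.

Lemma endo_coord_eq (f : {linear D -> D}) d d' i :
  coord i d = coord i d' -> coord i (f d) = coord i (f d').
Proof.
move=> dd'; apply/subr0_eq; rewrite -!linearB /=.
by apply: endo_coord0; rewrite linearB /= dd' subrr.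
Qed.

(** By [endo_coord_eq] an endomorphism acts coordinatewise, and on each coordinate it is zero or
    bijective. The projection [e] to the set [S] of coordinates where [f] acts nontrivially has the
    kernel and image of [f]. *)
Lemma direct_sum_ssr : strongly_self_regular D.
Proof.
apply: central_idem_ssr => f.
pose S i := exists d, coord i (f d) <> 0.
have [e eE] : exists e : {linear D -> D}, forall d i,
    (S i -> coord i (e d) = coord i d) /\ (~ S i -> coord i (e d) = 0).
  apply: (@graph_linear _ _ _ (fun d d' => forall i,
    (S i -> coord i d' = coord i d) /\ (~ S i -> coord i d' = 0))).
  - move=> d; pose v i := if `[<S i>] then coord i d else 0.
    have [i|d' d'E] := @direct_sumP _ _ _ v _ (coord_finite d).
      by rewrite /v; case: ifP => // _ /eqP.
    exists d' => i; rewrite d'E /v.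
    by case: ifP => /asboolP.
  - move=> a x y x' y' xy xy' i; have [s n] := xy i; have [s' n'] := xy' i.
    rewrite !linearP /=; split=> Si.
      by rewrite s // s'.
    by rewrite n // n' // scaler0 addr0.
  - move=> y y0; apply: coord_ext => i; rewrite linear0; have [s n] := y0 i.
    by have [/s|/n] := pselect (S i); rewrite ?linear0.
exists e; split=> [h d|d|d|d].
- apply: coord_ext => i; have [s n] := eE (h d) i.
  have [Si|Si] := pselect (S i).
    by rewrite s //; apply: endo_coord_eq; have [-> //] := eE d i.
  by rewrite n //; apply: endo_coord0; have [_ ->] := eE d i.
- apply: coord_ext => i; have [s n] := eE (e d) i.
  have [Si|Si] := pselect (S i); first by rewrite s.
  by rewrite n //; have [_ ->] := eE d i.
- split=> [fd|ed]; apply: coord_ext => i; rewrite linear0.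
    have [Si|Si] := pselect (S i); last by have [_ ->] := eE d i.
    have [s _] := eE d i; rewrite s //; have [d0 fd0] := Si.
    apply: contrapT => di0; apply: fd0.
    have [a aE] := genV (coord i d0) di0.
    rewrite (@endo_coord_eq f d0 (a *: d)) ?[RHS]linearZ //.
    by rewrite linearZ /= fd scaler0.
  have [Si|Si] := pselect (S i).
    apply: endo_coord0; have [s _] := eE d i.
    by rewrite -s // ed linear0.
  by apply: contrapT => fdi; apply: Si; exists d.
- split=> [[x _ <-]|ed].
    apply: coord_ext => i; have [s n] := eE (f x) i.
    have [Si|Si] := pselect (S i); first by rewrite s.
    by rewrite n //; apply: contrapT => fxi; apply: Si; exists x => /esym.
  (* Preimages are chosen per coordinate, and are [0] where [d] vanishes, to keep the support
     finite. *)
  have pre i : exists z, (z <> 0 -> coord i d <> 0) /\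
      forall x : D, coord i x = z -> coord i (f x) = coord i d.
    have [di0|di0] := pselect (coord i d = 0).
      by exists 0; split=> // x /(endo_coord0 f) ->.
    have [d0 d0i] : S i.
      by apply: contrapT => Si; apply: di0; rewrite -ed; have [_ ->] := eE d i.
    have [a aE] := genV (coord i d) d0i.
    exists (coord i (a *: d0)); split=> // x xE.
    by rewrite (endo_coord_eq f xE) !linearZ.
  pose v i := sval (cid (pre i)).
  have vP i : (v i <> 0 -> coord i d <> 0) /\
      forall x : D, coord i x = v i -> coord i (f x) = coord i d.
    by rewrite /v; case: (cid _).
  have [i|x xE] := @direct_sumP _ _ _ v _ (coord_finite d).
    by have [vi _] := vP i; move=> /vi /eqP.
  by exists x => //; apply: coord_ext => i; have [_ ->] := vP i.
Qed.

(** The supports of the images of the generators have a finite union, outside of which every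
    coordinate would vanish identically. *)
Lemma direct_sum_finite (M : lmodType R) (y : forall i, V i) :
  (forall i, y i <> 0) -> fin_gen_module M ->
  isomorphic_modules M D -> finite_set [set: I].
Proof.
move=> y0 [n [g gen]] [f [f' fK f'K]].
have finF : finite_set
    (\bigcup_(k in [set: 'I_n]) [set i | coord i (f (g k)) != 0]).
  by apply: bigcup_finite => [|k _]; [exact: finite_finset|exact: coord_finite].
apply: sub_finite_set finF => i _ /=.
apply: contrapT => no.
have fgi k : coord i (f (g k)) = 0.
  by apply: contrapT => /eqP gki; apply: no; exists k.
have all0 x : coord i (f x) = 0.
  have [c ->] := gen x; rewrite linear_sum.
  elim/big_rec: _ => [|k d _ dE]; first by rewrite linear0.
  by rewrite linearD /= dE addr0 !linearZ /= fgi scaler0.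
pose v j := if `[<j = i>] then y j else 0.
have [j|d dE] := @direct_sumP _ _ _ v _ (finite_set1 i).
  by rewrite /v; case: ifP => // /asboolP.
have := all0 (f' d); rewrite f'K dE /v; case: ifPn => [_|/asboolP //].
by move/y0.
Qed.

End DirectSumOfSimples.

(** * Choice of the index set, and the finitely generated case *)

Lemma finite_setT_bij (I : Type) : finite_set [set: I] ->
  exists n (q : 'I_n -> I), injective q /\ forall i, exists k, q k = i.
Proof.
elim/Pchoice: I => I /finite_seqP[s sE].
have sI i : i \in undup s by rewrite mem_undup; have : [set: I] i by []; rewrite sE.
exists (size (undup s)), (tnth (in_tuple (undup s))); split.
  by move=> k l; apply/tuple_uniqP; apply: undup_uniq.
by move=> i; have /(tuple.tnthP (in_tuple _))[k ->] := sI i; exists k.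
Qed.

(** Indices are underlying sets, not terms of [idealr], because several such terms may have the same
    elements; set extensionality then gives distinctness. *)
Lemma exists_annihilating_maximals (R : comNzRingType) (M : lmodType R) :
  exists (I : Type) (P : I -> idealr R),
  [/\ forall i, maximal_ideal (P i), distinct_ideals P,
      forall i, exists2 m : M, m != 0 & killed_by (P i) m
    & forall (Q : idealr R) (m : M), maximal_ideal Q -> killed_by Q m ->
       m <> 0 -> exists i, Q =i P i].
Proof.
pose S : set (set R) := [set A | exists Q : idealr R, [/\ maximal_ideal Q,
  A = [set a | a \in Q] & exists2 m : M, m != 0 & killed_by Q m]].
pose I := {A : set R | S A}.
pose P (i : I) : idealr R := sval (cid (proj2_sig i)).
have PP (i : I) : [/\ maximal_ideal (P i), sval i = [set a | a \in P i]
    & exists2 m : M, m != 0 & killed_by (P i) m].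
  by rewrite /P; case: (cid _).
exists I, P; split.
- by move=> i; have [] := PP i.
- move=> i j ij; suff: sval i = sval j.
    by case: i {ij} => A SA; case: j => B SB /= AB; apply: eq_exist.
  have [_ -> _] := PP i; have [_ -> _] := PP j.
  by apply/seteqP; split=> a /=; rewrite ij.
- by move=> i; have [] := PP i.
- move=> Q m mQ Qm m0.
  have SQ : S [set a | a \in Q].
    by exists Q; split=> //; exists m => //; apply/eqP.
  pose i : I := exist _ _ SQ; exists i => a; have [_ E _] := PP i.
  have := congr1 (fun A : set R => A a) E.
  by move=> /= Ea; apply/idP/idP; rewrite Ea.
Qed.

Section Decomposition.
Variables (R : comNzRingType) (M : lmodType R).
Hypothesis noeth : noetherian_ring R.
Hypothesis ssrM : strongly_self_regular M.
Hypothesis maxM : forall (J : prime_idealr R) (x : M),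
  (forall a, a *: x = 0 -> a \in J) -> maximal_ideal J.

(** A first decomposition, over all annihilating maximal ideals, shows the index type finite. Once
    it is enumerated, decomposing again replaces reindexing the sum. *)
Lemma ssr_fin_gen_decomposition : fin_gen_module M ->
  exists (k : nat) (P : 'I_k -> idealr R),
    [/\ forall i, maximal_ideal (P i), distinct_ideals P
      & isomorphic_modules M (dsum_lmod (fun i => quot_lmod (P i)))].
Proof.
move=> fgM; have [I [P [mP dP Pm cover]]] := exists_annihilating_maximals M.
have iso := isomorphic_direct_sum noeth ssrM maxM mP dP Pm cover.
have one_neq0 i : quot_proj (P i) 1 <> 0 by move/quot_proj_eq0; rewrite idealr1.
have /finite_setT_bij[n [q [qinj qsurj]]] := direct_sum_finite one_neq0 fgM iso.
exists n, (P \o q); split=> [i|i j ij|]; [exact: mP|exact: qinj (dP _ _ ij)|].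
apply: (isomorphic_direct_sum noeth ssrM maxM) => /= [i|i j ij|i|Q m mQ Qm m0].
- exact: mP.
- exact: qinj (dP _ _ ij).
- exact: Pm.
- by have [i] := cover Q m mQ Qm m0; have [k <-] := qsurj i; exists k.
Qed.

End Decomposition.

(** * The determinant trick *)

(** Multiply the relations by the adjugate of [A]. *)
Lemma cramer_lmod (R : comPzRingType) (M : lmodType R) n (A : 'M[R]_n)
    (g : 'I_n -> M) :
  (forall i, \sum_j A i j *: g j = 0) -> forall k, \det A *: g k = 0.
Proof.
move=> Ag k; have : \sum_j (\adj A *m A) k j *: g j = \det A *: g k.
  rewrite mul_adj_mx (bigD1 k) //= big1 => [|j jk]; last first.
    by rewrite mxE eq_sym (negPf jk) mulr0n scale0r.
  by rewrite mxE eqxx mulr1n addr0.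
move <-; under eq_bigr => j _ do rewrite mxE scaler_suml.
rewrite exchange_big big1 //= => i _.
under eq_bigr => j _ do rewrite -scalerA.
by rewrite -scaler_sumr Ag scaler0.
Qed.

(** As a polynomial in [t], the determinant of [1 - t C] has constant term [1]; evaluate at [a]. *)
Lemma det_1_sub_scale (R : comNzRingType) n (C : 'M[R]_n) a :
  exists b, \det (1%:M - a *: C) = 1 + b * a.
Proof.
pose p : {poly R} := \det (1%:M - 'X *: map_mx polyC C).
have pE t : p.[t] = \det (1%:M - t *: C).
  rewrite -horner_evalE -det_map_mx; congr (\det _).
  apply/matrixP => i j; rewrite !mxE.
  by rewrite rmorphB rmorphM rmorph_nat /= !horner_evalE hornerX hornerC.
have := pE 0; rewrite scale0r subr0 det1 -pE.
elim/poly_ind: p {pE} => [|q c _].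
  by rewrite !horner0 => <-; exists 0; rewrite mul0r addr0.
rewrite !hornerMXaddC mulr0 add0r => ->.
by exists q.[a]; rewrite addrC.
Qed.

(* As [a] acts invertibly on its image, [a M = a^2 M]; expressing [a g_i]
   through the [a^2 g_j] and taking determinants gives a multiple of
   [a^n (1 + b a)] that kills [M]. *)
Lemma ssr_nontorsion_unit (R : idomainType) (M : lmodType R) (x : M) (a : R) :
    strongly_self_regular M -> fin_gen_module M ->
    (forall b, b *: x = 0 -> b = 0) -> a != 0 ->
  exists b, b * a = 1.
Proof.
move=> ssrM [n [g gen]] x0 a0.
have [e [w [ce ee aw wa ea]]] := ssr_strongly_regular ( *:%R a) ssrM.
have a2 y : a *: y = a *: (a *: w y).
  rewrite /= in aw wa ea.
  by rewrite aw -linearZ /= ea.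
pose c i := sval (cid (gen (w (g i)))).
have cE i : w (g i) = \sum_j c i j *: g j by rewrite /c; case: (cid _).
pose C := \matrix_(i, j) c i j.
have /cramer_lmod detg : forall i, \sum_j (a *: (1%:M - a *: C)) i j *: g j = 0.
  move=> i; under eq_bigr => j _ do
    rewrite !mxE -scalerA scalerBl -[(a * c i j) *: _]scalerA.
  rewrite -scaler_sumr big_split /= sumrN -scaler_sumr -cE scalerDr scalerN -a2.
  rewrite (bigD1 i) //= eqxx scale1r big1 ?addr0 ?subrr // => j ji.
  by rewrite eq_sym (negPf ji) scale0r.
have [b bE] := det_1_sub_scale C a.
(* The determinant kills all generators, hence [x], so it is zero. It equals [a ^+ n * (1 + b * a)],
   and [R] is a domain. *)
have /x0 /eqP : \det (a *: (1%:M - a *: C)) *: x = 0.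
  have [d ->] := gen x; rewrite scaler_sumr big1 // => k _.
  by rewrite scalerA mulrC -scalerA detg scaler0.
rewrite detZ bE mulf_eq0 expf_eq0 (negPf a0) andbF /= addr_eq0 => /eqP b1.
by exists (- b); rewrite mulNr -b1.
Qed.

(** * Injective modules *)

Section Injective.
Variables (R : idomainType) (M : lmodType R).
Hypothesis ssrM : strongly_self_regular M.
Hypothesis injM : injective_module M.

(** Extend [r |-> r *: x] along multiplication by [a] on [R] and evaluate at [1]. *)
Lemma injective_divisible (a : R) (x : M) : a != 0 -> exists y, a *: y = x.
Proof.
move=> a0; pose i : {linear R^o -> R^o} := *:%R a.
have [g gE] : exists g : {linear R^o -> M}, forall r, g r = r *: x.
  apply: (@graph_linear _ _ _ (fun (r : R^o) y => y = r *: x)) => [r|b r _ s _ -> ->|_ ->].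
  - by exists (r *: x).
  - by rewrite scalerDl scalerA.
  - by rewrite scale0r.
have [|h hE] := @injM _ _ i g; first by move=> r s /(mulfI a0).
exists (h 1); rewrite -linearZ.
by have := hE 1; rewrite gE scale1r.
Qed.

(** Writing [x = a *: y], the square of multiplication by [a] kills [y], so reducedness gives
    [a *: y = 0]. *)
Lemma injective_torsionfree (a : R) (x : M) : a != 0 -> a *: x = 0 -> x = 0.
Proof.
move=> a0 ax; have [y yx] := injective_divisible x a0.
rewrite -yx; apply: (ssr_reduced (f := *:%R a) ssrM) => /=.
by rewrite yx.
Qed.

(* If [m] and [y] were independent, injectivity would extend
   [r m + s y |-> r y] to a nonzero nilpotent endomorphism of [M]. *)
Lemma injective_rank1 (m y : M) : m != 0 ->
  exists a b : R, a != 0 /\ a *: y = b *: m.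
Proof.
move=> m0; apply: contrapT => indep.
have y0 : y <> 0.
  by move=> y0; apply: indep; exists 1, 0; rewrite oner_eq0 y0 scaler0 scale0r.
have [i iE] : exists i : {linear (R^o * R^o)%type -> M},
    forall u, i u = (u.1 : R) *: m + (u.2 : R) *: y.
  apply: (@graph_linear _ _ _ (fun (u : (R^o * R^o)%type) z =>
    z = (u.1 : R) *: m + (u.2 : R) *: y)) => [u|b u _ v _ -> ->|_ ->] /=.
  - by exists ((u.1 : R) *: m + (u.2 : R) *: y).
  - by rewrite !scalerDl !scalerDr !scalerA addrACA.
  - by rewrite !scale0r addr0.
have [g gE] : exists g : {linear (R^o * R^o)%type -> M},
    forall u, g u = (u.1 : R) *: y.
  apply: (@graph_linear _ _ _ (fun (u : (R^o * R^o)%type) z =>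
    z = (u.1 : R) *: y)) => [u|b u _ v _ -> ->|_ ->] /=.
  - by exists ((u.1 : R) *: y).
  - by rewrite scalerDl scalerA.
  - by rewrite scale0r.
have i0 u : i u = 0 -> u = 0.
  case: u => r s; rewrite iE /= => rs.
  have s0 : s = 0.
    apply/eqP; apply: contrapT => /negP s0; apply: indep; exists s, (- r).
    by split=> //; apply/eqP; rewrite scaleNr -addr_eq0 addrC rs.
  rewrite s0 scale0r addr0 in rs.
  have [-> //|r0] := eqVneq r 0; first by rewrite s0.
  by move/eqP: m0; case; apply: injective_torsionfree r0 rs.
have [|h hE] := @injM _ _ i g.
  by move=> u v uv; apply/subr0_eq/i0; rewrite linearB /= uv subrr.
have hm : h m = y.
  have := hE (1, 0); rewrite iE gE /= !scale1r scale0r addr0; exact.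
have hy : h y = 0.
  have := hE (0, 1); rewrite iE gE /= !scale1r scale0r add0r scale0r; exact.
by apply: y0; rewrite -hm; apply: (ssr_reduced ssrM); rewrite hm.
Qed.

(** The isomorphism sends [y] to [b / a] whenever [a *: y = b *: m]. Torsion-freeness makes it well
    defined and injective, divisibility makes it surjective. *)
Lemma injective_ssr_fraction :
  nonzero_module M -> isomorphic_modules M (fraction_module R).
Proof.
move=> [m m0].
have [f fP] : exists f : {linear M -> fraction_module R}, forall y, exists a b : R,
    [/\ a != 0, a *: y = b *: m & a%:F * (f y : {fraction R}) = b%:F].
  apply: (@graph_linear _ _ _ (fun y (z : fraction_module R) => exists a b : R,
    [/\ a != 0, a *: y = b *: m & a%:F * (z : {fraction R}) = b%:F])).
  - move=> y; have [a [b [a0 ab]]] := injective_rank1 y m0.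
    exists (b%:F / a%:F), a, b; split=> //.
    by rewrite mulrC divfK // tofrac_eq0.
  - move=> r y z y' z' [a [b [a0 ab za]]] [a' [b' [a'0 ab' za']]].
    exists (a * a'), (r * a' * b + a * b'); split; first by rewrite mulf_neq0.
      rewrite scalerDr scalerDl -!scalerA ab' -ab; congr (_ + _).
      by rewrite !scalerA; congr (_ *: _); ring.
    transitivity ((a%:F * a'%:F) *
      (r%:F * (z : {fraction R}) + (z' : {fraction R}))).
      by rewrite -rmorphM.
    by rewrite rmorphD !rmorphM /= -za -za'; ring.
  - move=> z [a [b [a0 ab za]]].
    have b0 : b = 0.
      apply/eqP; apply: contrapT => /negP b0; move/eqP: m0; apply.
      by apply: injective_torsionfree b0 _; rewrite -ab scaler0.
    apply/eqP; move/eqP: za; rewrite b0 rmorph0 mulf_eq0 tofrac_eq0.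
    by rewrite (negPf a0).
apply: (isomorphic_of_bij (f := f)) => [y fy|z].
  have [a [b [a0 ab]]] := fP y; rewrite fy mulr0 => /esym/eqP.
  rewrite tofrac_eq0 => /eqP b0; apply: injective_torsionfree a0 _.
  by rewrite ab b0 scale0r.
have [d [n [d0 dn]]] := fraction_exists z.
have [y yE] := injective_divisible (n *: m) d0; exists y.
have [a [b [a0 ab fy]]] := fP y.
have andb : a * n = d * b.
  apply/subr0_eq; apply/eqP; apply: contrapT => /negP nz.
  move/eqP: m0; apply; apply: injective_torsionfree nz _.
  by rewrite scalerBl -!scalerA -ab -yE !scalerA mulrC subrr.
have aF0 : a%:F != 0 by rewrite tofrac_eq0.
have dF0 : d%:F != 0 by rewrite tofrac_eq0.
apply: (mulfI aF0); apply: (mulfI dF0); rewrite fy mulrCA dn -!rmorphM.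
by rewrite andb.
Qed.

End Injective.

(** * The three equivalences *)

Lemma quot_direct_sum_ssr (R : comNzRingType) (M : lmodType R) (I : Type)
    (P : I -> idealr R) :
  (forall i, maximal_ideal (P i)) -> distinct_ideals P ->
  isomorphic_modules M (dsum_lmod (fun i => quot_lmod (P i))) ->
  strongly_self_regular M.
Proof.
move=> mP dP iso; apply: (isomorphic_ssr iso); apply: (direct_sum_ssr mP dP).
  by move=> i y a; apply: quot_lmod_killed.
by move=> i y z; apply: quot_lmod_generator.
Qed.

Theorem corollary3p8 (R : idomainType) (hR : dedekind_domain R) :
  [/\ (* (i) *)
      forall M : lmodType R, nonzero_module M -> torsion_module M ->
        (strongly_self_regular M <->
         exists (I : Type) (P : I -> idealr R),
           [/\ forall i : I, maximal_ideal (P i), distinct_ideals P &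
               isomorphic_modules M (direct_sum (fun i : I => quot_module (P i)))]),
      (* (ii) *)
      forall M : lmodType R, nonzero_module M -> fin_gen_module M ->
        (strongly_self_regular M <->
         exists (k : nat) (P : 'I_k -> idealr R),
           [/\ forall i : 'I_k, maximal_ideal (P i), distinct_ideals P &
               isomorphic_modules M (direct_sum (fun i : 'I_k => quot_module (P i)))])
    & (* (iii) *)
      forall M : lmodType R, nonzero_module M -> injective_module M ->
        (strongly_self_regular M <-> isomorphic_modules M (fraction_module R))].
Proof.
have [noeth _ dim1] := hR.
have torsion_max (M : lmodType R) : torsion_module M ->
    forall (J : prime_idealr R) (x : M),
    (forall a, a *: x = 0 -> a \in J) -> maximal_ideal J.
  move=> tM J x xJ; apply: dim1; have [a a0 ax] := tM x.
  by exists a => //; apply: xJ.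
split=> M nzM.
- move=> tM; split=> [ssrM|[I [P [mP dP iso]]]]; last exact: quot_direct_sum_ssr iso.
  have maxM := torsion_max M tM.
  have [I [P [mP dP Pm cover]]] := exists_annihilating_maximals M.
  by exists I, P; split=> //; apply: isomorphic_direct_sum.
- move=> fgM; split=> [ssrM|[I [P [mP dP iso]]]]; last exact: quot_direct_sum_ssr iso.
  apply: ssr_fin_gen_decomposition => //.
  have [tM|ntM] := pselect (torsion_module M); first exact: torsion_max.
  have [x x0] : exists x : M, forall b, b *: x = 0 -> b = 0.
    apply: contrapT => no; apply: ntM => x; apply: contrapT => nx.
    apply: no; exists x => b bx; apply: contrapT => /eqP b0.
    by apply: nx; exists b.
  (* In the non-torsion case [R] is a field: a nonzero element of the proper ideal [K] would be a
     unit, so [K] is zero. *)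
  move=> J _ _ K JK a; apply/idP/idP; last exact: JK.
  have [-> _|a0 aK] := eqVneq a 0; first exact: idealr0.
  have [b ba] := ssr_nontorsion_unit ssrM fgM x0 a0.
  by have := idealMr b aK; rewrite ba idealr1.
- move=> injM; split=> [ssrM|iso]; first exact: injective_ssr_fraction.
  exact: isomorphic_ssr iso (@fraction_module_ssr R).
Qed.
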